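(* Let $k\ge 3$ and let $P_\pi$ be a weighted poset on the set of coordinate positions $\{1,\dots,2^k\}$. Let $\alpha,\beta,\gamma,\delta,\beta',\gamma',\delta'$ be distinct coordinate positions such that $\{\alpha,\beta,\gamma,\delta\}$, $\{\beta,\beta',\gamma,\gamma'\}$, $\{\beta,\beta',\delta,\delta'\}$ and $\{\gamma,\gamma',\delta,\delta'\}$ are codewords of the extended Hamming code $\widetilde{\mathcal H}_k$. Suppose that one of the following holds: (1) $(\Omega_1^1(1),\Omega_1^2(1),\Omega_1^2(2))=(3,1,2^k-4)$, $\Delta_1^1=\{\alpha,\beta,\gamma\}$, $\Delta_1^2=\{\delta\}$, and $\Delta_2^2(\alpha)=P_\pi\setminus(\Delta_1^1\cup\Delta_1^2)$; (2) $(\Omega_1^1(1),\Omega_1^2(1),\Omega_1^2(2))=(4,3,2^k-7)$, $\Delta_1^1=\{\alpha,\beta,\gamma,\delta'\}$, $\Delta_1^2=\{\beta',\gamma',\delta\}$, and $\Delta_2^2(\alpha)=P_\pi\setminus(\Delta_1^1\cup\Delta_1^2)$. Then $\widetilde{\mathcal H}_k$ is a $2$-perfect $P_\pi$-code.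
   Context: Binary vectors are identified with their supports. A weighted poset $P_\pi$ is a finite poset $(P,\preceq)$ with a function $\pi:P\to\{1,2,3,\dots\}$. With $P=\{1,\dots,n\}$, for $x\in\mathbb{F}_2^n$ let $\langle x\rangle_P$ be the smallest order ideal (down-closed subset) containing the support of $x$, $w_{P_\pi}(x)=\sum_{i\in\langle x\rangle_P}\pi(i)$, and $d_{P_\pi}(x,y)=w_{P_\pi}(x-y)$. For $i\in P$, $\langle i\rangle$ and $w_{P_\pi}(i)$ refer to the singleton $\{i\}$. Let $S_{P_\pi}(x;r)=\{y: d_{P_\pi}(x,y)\le r\}$. A set $C\subseteq\mathbb{F}_2^n$ is an $r$-perfect $P_\pi$-code if the spheres $S_{P_\pi}(c;r)$, $c\in C$, are pairwise disjoint and their union is $\mathbb{F}_2^n$. $\Omega_j^\omega(i)$ is the number of order ideals of $P_\pi$ of size $i$, total $\pi$-weight $\omega$, with exactly $j$ maximal elements. $\Delta_i^\omega=\{x\in P: |\langle x\rangle_P|=i,\ w_{P_\pi}(x)=\omega\}$, so $\Omega_1^\omega(i)=|\Delta_i^\omega|$; for $a\in P$, $\Delta_i^\omega(a)=\{x\in P: x\succeq a\}\cap\Delta_i^\omega$. $\widetilde{\mathcal H}_k\subseteq\mathbb{F}_2^{2^k}$ is the extended Hamming code: the null space of the $(k+1)\times2^k$ binary matrix whose first row is all ones and whose remaining $k$ rows form the matrix whose $i$-th column is the binary representation of $i-1$. *)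

(* Defs.v *)
From HB Require Import structures.
From mathcomp Require Import all_boot all_order all_algebra.

Set Implicit Arguments.
Unset Strict Implicit.
Unset Printing Implicit Defensive.

Import GRing.Theory.

(* Coordinate positions 1, ..., n are represented by 'I_n, position p being the
   ordinal p - 1.  The order is a bare relation because 'I_n already carries
   its canonical total order. *)
Record wposet (n : nat) := WPoset {
  wle : rel 'I_n;
  wle_refl : reflexive wle;
  wle_anti : antisymmetric wle;
  wle_trans : transitive wle;
  wt : 'I_n -> nat;
  wt_gt0 : forall i, 0 < wt i }.

Section WeightedPoset.
Variables (n : nat) (P : wposet n).

Definition is_ideal (I : {set 'I_n}) : bool :=
  [forall i in I, forall j, wle P j i ==> (j \in I)].

(* The smallest ideal containing A: ideals are closed under intersection. *)
Definition ideal_gen (A : {set 'I_n}) : {set 'I_n} :=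
  \bigcap_(I : {set 'I_n} | is_ideal I && (A \subset I)) I.

Definition maximals (I : {set 'I_n}) : {set 'I_n} :=
  [set x in I | [forall y in I, wle P x y ==> (y == x)]].

Definition pweight (A : {set 'I_n}) : nat :=
  \sum_(i in ideal_gen A) wt P i.

Definition supp (x : 'rV['F_2]_n) : {set 'I_n} := [set i | x 0%R i != 0%R].

Definition pdist (x y : 'rV['F_2]_n) : nat := pweight (supp (x - y)%R).

Definition sphere (x : 'rV['F_2]_n) (r : nat) : {set 'rV['F_2]_n} :=
  [set y | pdist x y <= r].

Definition perfect_code (r : nat) (C : {set 'rV['F_2]_n}) : Prop :=
  (forall c c', c \in C -> c' \in C -> c != c' ->
     [disjoint sphere c r & sphere c' r]) /\
  \bigcup_(c in C) sphere c r = [set: 'rV['F_2]_n].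

(* Omega j w i is $\Omega_j^w(i)$. *)
Definition Omega (j w i : nat) : nat :=
  #|[set I : {set 'I_n} | [&& is_ideal I, #|I| == i,
       \sum_(x in I) wt P x == w & #|maximals I| == j]]|.

(* Delta i w is $\Delta_i^w$ and Delta_above i w a is $\Delta_i^w(a)$. *)
Definition Delta (i w : nat) : {set 'I_n} :=
  [set x | (#|ideal_gen [set x]| == i) && (pweight [set x] == w)].

Definition Delta_above (i w : nat) (a : 'I_n) : {set 'I_n} :=
  [set x | wle P a x] :&: Delta i w.

End WeightedPoset.

Definition vec_of (n : nat) (A : {set 'I_n}) : 'rV['F_2]_n :=
  (\row_i (i \in A)%:R)%R.

(* The column of position p = c + 1 is the binary representation of p - 1 = c,
   most significant bit on top. *)
Definition bin_mx (k : nat) : 'M['F_2]_(k, 2 ^ k) :=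
  (\matrix_(i < k, c < 2 ^ k) (odd (c %/ 2 ^ (k - i.+1)))%:R)%R.

Definition ext_hamming_mx (k : nat) : 'M['F_2]_(1 + k, 2 ^ k) :=
  col_mx (const_mx 1%R) (bin_mx k).

Definition ext_hamming (k : nat) : {set 'rV['F_2]_(2 ^ k)} :=
  [set x | (ext_hamming_mx k *m x^T == 0)%R].

(* Main.v *)
Require Import Defs.
From HB Require Import structures.
From mathcomp Require Import all_boot all_order all_algebra.

(** Write [s i] for the column of the parity-check matrix at position [i]. The
    ball of radius 2 around 0 contains exactly one vector of each syndrome,
    which is what perfectness of a linear code means ([syndrome_perfect]).

    The first row of the matrix is all ones and its columns are all the vectors
    that begin with 1. Hence each odd syndrome is [s y] for exactly one position
    [y], and, for a fixed position [a], each even one is [s a + s y] for exactly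
    one [y]. So it is enough that the supports in the ball are the singletons
    together with one support of syndrome [s a + s y] for each position [y]
    ([perfect_of_transversal]).

    In both cases of the theorem the poset is very flat: the minimal elements
    are those of [Delta P 1 1], of weight 1, and those of [Delta P 1 2], of
    weight 2, while every other element has weight 1 and covers only [a]. The
    supports of weight at most 2 are then the empty set, the singletons, the
    pairs [{a, y}] with [y] outside [Delta P 1 2], and the pairs inside
    [Delta P 1 1 :\ a] ([pweight_leq2]). The first three kinds supply the
    singletons and the required representative of [s a + s y] for each [y]
    outside [Delta P 1 2]. For the heavy minimal elements [m] the pair [{a, m}]
    has weight 3, and a pair inside [Delta P 1 1 :\ a] must replace it: the
    dependencies given by the code words match these pairs with the heavy
    elements ([hamming_perfect_of_pairs]). In the first case [{b, c}] replaces
    [{a, d}]; in the second one, moreover, [{b, d'}] replaces [{a, c'}] and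
    [{c, d'}] replaces [{a, b'}]. *)

Set Implicit Arguments.
Unset Strict Implicit.
Unset Printing Implicit Defensive.

Import GRing.Theory.

(** * Binary vectors and their supports *)

Lemma opp_mxF2 m n (x : 'M['F_2]_(m, n)) : (- x = x)%R.
Proof. by apply/matrixP => i j; rewrite !mxE (oppr_pchar2 (pchar_Fp _)). Qed.

Lemma eq_mxF2 m n (x y : 'M['F_2]_(m, n)) : (x + y = 0)%R -> x = y.
Proof. by move/eqP; rewrite addr_eq0 opp_mxF2 => /eqP. Qed.

Lemma addrKF2 m n (x y : 'M['F_2]_(m, n)) : (x + y + y = x)%R.
Proof. by rewrite -{2}[y]opp_mxF2 addrK. Qed.

Lemma addrKAF2 m n (x y z t : 'M['F_2]_(m, n)) :
  (x + (y + z) + (y + (z + t)) = x + t)%R.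
Proof. by rewrite [(y + (z + t))%R]addrA [LHS]addrA addrKF2. Qed.

Lemma suppK n : cancel (@supp n) (@vec_of n).
Proof.
move=> x; apply/rowP => i; rewrite mxE inE.
by case: (x 0%R i) => [[|[|m]] hm] //; apply/val_inj.
Qed.

Lemma supp_vec_of n (A : {set 'I_n}) : supp (vec_of A) = A.
Proof. by apply/setP => i; rewrite inE mxE; case: (i \in A). Qed.

Lemma vec_ofU n (A B : {set 'I_n}) :
  [disjoint A & B] -> vec_of (A :|: B) = (vec_of A + vec_of B)%R.
Proof.
move=> dAB; apply/rowP => i; rewrite !mxE inE.
have := disjointFr dAB (x := i).
by case: (i \in A) => [-> //|_] /=; rewrite ?addr0 ?add0r.
Qed.

Lemma vec_of0 n : vec_of (set0 : {set 'I_n}) = 0%R.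
Proof. by apply/rowP => i; rewrite !mxE inE. Qed.

Lemma vec_of2 n (x y : 'I_n) : x != y ->
  vec_of [set x; y] = (vec_of [set x] + vec_of [set y])%R.
Proof. by move=> xy; rewrite vec_ofU // disjoints1 inE. Qed.

Lemma vec_of4 n (x y z t : 'I_n) : uniq [:: x; y; z; t] ->
  vec_of [set x; y; z; t] =
  (vec_of [set x] + vec_of [set y] + (vec_of [set z] + vec_of [set t]))%R.
Proof.
rewrite /= !inE !negb_or => /and4P[/and3P[xy xz xt] /andP[yz yt] zt _].
rewrite -setUA vec_ofU ?vec_of2 //.
rewrite disjoints_subset; apply/subsetP => i; rewrite !inE.
by case/orP => /eqP->; rewrite negb_or; apply/andP.
Qed.

(** * Spheres around the words of a linear code *)

Section Syndrome.
Variables (n m : nat) (H : 'M['F_2]_(m, n)).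

Definition syndrome (x : 'rV['F_2]_n) : 'cV['F_2]_m := (H *m x^T)%R.

Lemma syndromeD x y : syndrome (x + y)%R = (syndrome x + syndrome y)%R.
Proof. by rewrite /syndrome linearD mulmxDr. Qed.

(** Words whose spheres meet in [y] differ from [y] by two ball elements of the
    same syndrome; and [y] is decoded by subtracting the ball element that has
    its syndrome. *)
Lemma syndrome_perfect (P : wposet n) r :
    (forall A B, pweight P A <= r -> pweight P B <= r ->
       syndrome (vec_of A) = syndrome (vec_of B) -> A = B) ->
    (forall x, exists2 A,
       pweight P A <= r & syndrome (vec_of A) = syndrome x) ->
  perfect_code P r [set x | (H *m x^T == 0)%R].
Proof.
move=> inj onto; split.
  move=> x x'; rewrite !inE => /eqP Hx /eqP Hx' xx'.
  rewrite disjoints_subset; apply/subsetP => y; rewrite !inE => xy.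
  apply/negP => x'y; case/eqP: xx'.
  have e : supp (x - y)%R = supp (x' - y)%R.
    apply: inj => //; rewrite !suppK !opp_mxF2 !syndromeD.
    by rewrite /syndrome Hx Hx'.
  by apply: (addIr (- y)%R); rewrite -[LHS]suppK e suppK.
apply/setP => y; rewrite inE; apply/bigcupP.
have [A wA sA] := onto y; exists (y + vec_of A)%R; rewrite inE.
  by rewrite -/(syndrome _) syndromeD sA -{2}[syndrome y]opp_mxF2 subrr.
by rewrite /pdist addrAC subrr add0r supp_vec_of.
Qed.

End Syndrome.

(** * The extended Hamming code *)

(** Halving drops the lowest bit, so induction on the number of bits applies. *)
Lemma bits_inj k m n : m < 2 ^ k -> n < 2 ^ k ->
  (forall i, i < k -> odd (m %/ 2 ^ i) = odd (n %/ 2 ^ i)) -> m = n.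
Proof.
elim: k m n => [|k IH] m n; first by rewrite expn0 !ltnS !leqn0 => /eqP-> /eqP->.
rewrite expnS => mk nk bits.
rewrite -(odd_double_half m) -(odd_double_half n).
have := bits 0 isT; rewrite expn0 !divn1 => ->; congr (_ + _.*2).
apply: IH; rewrite -?divn2 ?ltn_divLR // 1?mulnC // => i ik.
by rewrite -!divnMA -expnS; apply: bits.
Qed.

Section Hamming.
Variable k : nat.

Local Notation syn := (@syndrome (2 ^ k) (1 + k) (ext_hamming_mx k)).
Local Notation e i := (vec_of [set i]).

Lemma syndromeE x :
  syn x = col_mx (const_mx 1 *m x^T)%R (bin_mx k *m x^T)%R.
Proof. by rewrite /syndrome mul_col_mx. Qed.

Lemma mul_unit_col m (A : 'M['F_2]_(m, 2 ^ k)) i :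
  (A *m (e i)^T)%R = col i A.
Proof.
apply/colP => j; rewrite !mxE (bigD1 i) //= !mxE inE eqxx mulr1.
by rewrite big1 ?addr0 // => t ti; rewrite !mxE inE (negPf ti) mulr0.
Qed.

Lemma bin_col_inj : injective (fun i : 'I_(2 ^ k) => col i (bin_mx k)).
Proof.
move=> i j /colP eij; apply/val_inj/(bits_inj (ltn_ord i) (ltn_ord j)) => t tk.
have tk' : k - t.+1 < k by rewrite ltn_subrL (leq_ltn_trans _ tk).
have := eij (Ordinal tk'); rewrite !mxE /= subnSK // subKn ?(ltnW tk) //.
by do 2!case: odd.
Qed.

(** The columns are distinct, and there are as many of them as binary vectors of
    length [k]. *)
Lemma bin_col_onto (v : 'cV['F_2]_k) : exists i, col i (bin_mx k) = v.
Proof.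
have /codomP[i ->] : v \in codom (fun i : 'I_(2 ^ k) => col i (bin_mx k)).
  apply: inj_card_onto bin_col_inj _ v.
  by rewrite card_mx card_Fp // card_ord muln1.
by exists i.
Qed.

Definition parity (x : 'rV['F_2]_(2 ^ k)) : 'cV['F_2]_1 :=
  (const_mx 1 *m x^T)%R.

Lemma parityD x y : parity (x + y)%R = (parity x + parity y)%R.
Proof. exact: syndromeD. Qed.

Lemma parity_unit i : parity (e i) = const_mx 1%R.
Proof. by rewrite /parity mul_unit_col; apply/colP => j; rewrite !mxE. Qed.

Lemma parityP x : parity x = 0%R \/ parity x = const_mx 1%R.
Proof.
have [z|nz] := eqVneq (parity x 0%R 0%R) 0%R; [left|right];
  apply/colP => j; rewrite ord1 [RHS]mxE //.
by case: (parity x 0%R 0%R) nz => [[|[|t]] ht] // _; apply/val_inj.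
Qed.

Lemma eq_syndrome_parity x y : syn x = syn y -> parity x = parity y.
Proof. by rewrite !syndromeE => /eq_col_mx[]. Qed.

Lemma syndrome_unit_inj i j : syn (e i) = syn (e j) -> i = j.
Proof.
by rewrite !syndromeE => /eq_col_mx[_]; rewrite !mul_unit_col => /bin_col_inj.
Qed.

Lemma odd_syndrome x : parity x = const_mx 1%R -> exists i, syn (e i) = syn x.
Proof.
move=> px; have [i hi] := bin_col_onto (bin_mx k *m x^T)%R.
by exists i; rewrite !syndromeE -!/(parity _) px parity_unit mul_unit_col hi.
Qed.

(** A code word of weight four is a linear dependency between four columns,
    stated so that one column can be eliminated. *)
Lemma hamming4 x y z t : uniq [:: x; y; z; t] ->
  vec_of [set x; y; z; t] \in ext_hamming k ->
  (syn (e x) = syn (e y) + (syn (e z) + syn (e t)))%R.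
Proof.
move=> u; rewrite inE => /eqP c; apply: eq_mxF2.
by rewrite addrA -!syndromeD -vec_of4.
Qed.

(** Parity separates the two families of supports. Within each family the
    syndrome determines [y], because the columns are distinct; every odd syndrome
    is a column, and adding the column of [a] reduces the even ones to it. *)
Lemma perfect_of_transversal (P : wposet (2 ^ k)) r a
    (f : 'I_(2 ^ k) -> {set 'I_(2 ^ k)}) :
    (forall A, pweight P A <= r <->
       (exists y, A = [set y]) \/ (exists y, A = f y)) ->
    (forall y, syn (vec_of (f y)) = (syn (e a) + syn (e y))%R) ->
  perfect_code P r (ext_hamming k).
Proof.
move=> ball synf.
have parf y : parity (vec_of (f y)) = 0%R.
  have := synf y; rewrite -syndromeD => /eq_syndrome_parity ->.
  by rewrite parityD !parity_unit -{2}[const_mx 1%R]opp_mxF2 subrr.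
have par01 : (0 : 'cV['F_2]_1)%R <> const_mx 1%R.
  by move/colP/(_ 0%R); rewrite !mxE.
apply: syndrome_perfect.
  move=> A B /ball[[y ->]|[y ->]] /ball[[z ->]|[z ->]] eAB.
  - by rewrite (syndrome_unit_inj eAB).
  - by have := eq_syndrome_parity eAB; rewrite parf parity_unit => /esym/par01.
  - by have := eq_syndrome_parity eAB; rewrite parf parity_unit => /par01.
  - by move: eAB; rewrite !synf => /addrI/syndrome_unit_inj ->.
move=> x; have [px|px] := parityP x.
  have [|i hi] := @odd_syndrome (e a + x)%R.
    by rewrite parityD px parity_unit addr0.
  exists (f i); first by apply/ball; right; exists i.
  by rewrite synf hi syndromeD addrA -{2}[syn (e a)]opp_mxF2 subrr add0r.
have [i hi] := odd_syndrome px.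
by exists [set i] => //; apply/ball; left; exists i.
Qed.

End Hamming.

(** * Supports of small weight *)


Section Ideals.
Variables (n : nat) (P : wposet n).
Implicit Types A B : {set 'I_n}.

Lemma ideal_genE A : ideal_gen P A = [set x | [exists i in A, wle P x i]].
Proof.
apply/setP => x; rewrite inE.
apply/bigcapP/exists_inP => [/(_ [set y | [exists i in A, wle P y i]])|].
  rewrite inE => down; apply/exists_inP/down/andP; split.
    apply/forall_inP => y; rewrite inE => /exists_inP[i iA yi].
    apply/forallP => z; apply/implyP => zy; rewrite inE.
    by apply/exists_inP; exists i => //; apply: wle_trans yi.
  apply/subsetP => i iA; rewrite inE; apply/exists_inP; exists i => //.
  exact: wle_refl.
case=> i iA xi I /andP[/forall_inP iI /subsetP AI].
by have /forallP/(_ x)/implyP/(_ xi) := iI _ (AI _ iA).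
Qed.

Lemma mem_ideal_gen A x i : i \in A -> wle P x i -> x \in ideal_gen P A.
Proof. by move=> iA xi; rewrite ideal_genE inE; apply/exists_inP; exists i. Qed.

Lemma sub_ideal_gen A : A \subset ideal_gen P A.
Proof. by apply/subsetP => x xA; apply: mem_ideal_gen xA (wle_refl _ _). Qed.

(** The ideal generated by [A] is the union of the principal ideals of its
    elements. *)
Lemma ideal_gen_mem A x : x \in ideal_gen P A ->
  exists2 i, i \in A & x \in ideal_gen P [set i].
Proof.
rewrite {1}ideal_genE inE => /exists_inP[i iA xi]; exists i => //.
by apply: mem_ideal_gen xi; rewrite inE.
Qed.

Lemma leq_pweight A B :
  B \subset ideal_gen P A -> \sum_(x in B) wt P x <= pweight P A.
Proof.
by move=> /setIidPr BA; rewrite /pweight [leqRHS](big_setID B) /= BA leq_addr.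
Qed.

Lemma card_leq_pweight A B : B \subset ideal_gen P A -> #|B| <= pweight P A.
Proof.
move=> BA; apply: leq_trans (leq_pweight BA).
by rewrite -sum1_card; apply: leq_sum => x _; apply: wt_gt0.
Qed.

End Ideals.

Section SmallWeight.
Variables (n : nat) (P : wposet n) (a : 'I_n).
Implicit Types A : {set 'I_n}.

Local Notation L := (Delta P 1 1).
Local Notation M := (Delta P 1 2).

Hypothesis aL : a \in L.
Hypothesis rest : Delta_above P 2 2 a = ~: (L :|: M).

Lemma ideal_minimal w x : x \in Delta P 1 w ->
  ideal_gen P [set x] = [set x] /\ wt P x = w.
Proof.
rewrite inE => /andP[/eqP c1 /eqP <-].
have e : [set x] = ideal_gen P [set x].
  by apply/eqP; rewrite eqEcard sub_ideal_gen c1 cards1.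
by rewrite /pweight -e big_set1; split.
Qed.

Lemma ideal_rest x : x \notin L -> x \notin M ->
  ideal_gen P [set x] = [set a; x] /\ wt P x = 1.
Proof.
move=> xL xM.
have : x \in Delta_above P 2 2 a by rewrite rest in_setC in_setU negb_or xL.
have xa : a != x by apply: contraNneq xL => <-.
rewrite !inE => /and3P[ax /eqP c2 /eqP w2].
have e : [set a; x] = ideal_gen P [set x].
  apply/eqP; rewrite eqEcard cards2 xa c2 andbT subUset !sub1set.
  by rewrite !(@mem_ideal_gen _ _ _ _ x) ?inE ?wle_refl.
split=> //; move: w2; rewrite /pweight -e big_setU1 ?inE //= big_set1.
by rewrite (ideal_minimal aL).2 => -[].
Qed.

Lemma heavy_notin_L m : m \in M -> m \notin L.
Proof. by rewrite !inE => /andP[_ /eqP ->]; rewrite andbF. Qed.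

Lemma wt_not_heavy x : x \notin M -> wt P x = 1.
Proof.
by have [/ideal_minimal[]|xL /(ideal_rest xL)[]] := boolP (x \in L).
Qed.

(** Once [a] is present, the support is already an ideal, as [a] is the only
    element that can lie strictly below another one. *)
Lemma pweight_mem A : a \in A -> pweight P A = \sum_(x in A) wt P x.
Proof.
rewrite /pweight => aA; suff -> : ideal_gen P A = A by [].
apply/eqP; rewrite eqEsubset sub_ideal_gen andbT; apply/subsetP => x.
case/ideal_gen_mem => i iA.
have [/ideal_minimal[-> _]|iL] := boolP (i \in L); first by rewrite inE => /eqP->.
have [/ideal_minimal[-> _]|iM] := boolP (i \in M); first by rewrite inE => /eqP->.
by rewrite (ideal_rest iL iM).1 !inE => /pred2P[->|->].
Qed.

(** Each element has weight at least 1, so a support of weight at most 2 has at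
    most two elements. A pair is too heavy when it avoids [a] and contains an
    element above [a], since then its ideal has three elements, or when it
    contains an element of [M]. *)
Lemma pweight_leq2 A : pweight P A <= 2 <->
  [\/ A = set0, exists y, A = [set y],
      exists2 y, (y != a) && (y \notin M) & A = [set a; y]
    | A \subset L :\ a /\ #|A| = 2].
Proof.
split=> [wA|[->|[y ->]|[y /andP[ya yM] ->]|[AL A2]]].
- have := leq_trans (card_leq_pweight (sub_ideal_gen P A)) wA.
  have [aA|aA] := boolP (a \in A); last first.
    rewrite leq_eqVlt ltnS => /predU1P[A2|].
      constructor 4; split=> //; apply/subsetP => x xA.
      have xa : x != a by apply: contraNneq aA => <-.
      rewrite in_setD1 xa /=; apply: contraLR wA => xL; rewrite -ltnNge.
      have [xM|xM] := boolP (x \in M).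
        apply: leq_trans (leq_pweight (sub_ideal_gen P A)).
        rewrite (big_setD1 x) //= (ideal_minimal xM).2.
        have /cards1P[y ->] : #|A :\ x| == 1.
          by have := cardsD1 x A; rewrite xA A2 add1n => /eqP; rewrite eqSS eq_sym.
        by rewrite big_set1; apply: (leq_add (leqnn 2) (wt_gt0 P y)).
      (* [x] lies above [a], so [a] enters the ideal. *)
      have -> : 3 = #|a |: A| by rewrite cardsU1 aA A2.
      apply: card_leq_pweight; rewrite subUset sub_ideal_gen sub1set andbT.
      have := setU11 a [set x]; rewrite -(ideal_rest xL xM).1 ideal_genE inE.
      by case/exists_inP => i; rewrite inE => /eqP->; apply: mem_ideal_gen.
    rewrite leq_eqVlt ltnS leqn0 cards_eq0.
    case/predU1P => [/eqP/cards1P|/eqP]; first by constructor 2.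
    by constructor 1.
  rewrite (cardsD1 a) aA !ltnS leq_eqVlt ltnS leqn0 cards_eq0.
  case/predU1P => [/eqP/cards1P[y Ay]|/eqP A0]; last first.
    by constructor 2; exists a; rewrite -(setD1K aA) A0 setU0.
  have /setD1P[ya yA] : y \in A :\ a by rewrite Ay inE.
  have eA : A = [set a; y] by rewrite -(setD1K aA) Ay.
  constructor 3; exists y => //; rewrite ya; apply: contraL wA => yM.
  rewrite -ltnNge pweight_mem // eA big_setU1 ?inE 1?eq_sym //= big_set1.
  by rewrite (ideal_minimal yM).2 (ideal_minimal aL).2.
- by rewrite /pweight big1 // => x; case/ideal_gen_mem => i; rewrite inE.
- have [|yL] := boolP (y \in L); first by rewrite inE => /andP[_ /eqP ->].
  have [|yM] := boolP (y \in M); first by rewrite inE => /andP[_ /eqP ->].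
  have : y \in Delta_above P 2 2 a by rewrite rest in_setC in_setU negb_or yL.
  by rewrite !inE => /and3P[_ _ /eqP ->].
- rewrite pweight_mem ?set21 // big_setU1 ?inE 1?eq_sym //= big_set1.
  by rewrite (ideal_minimal aL).2 wt_not_heavy.
- suff -> : pweight P A = #|A| by rewrite A2.
  have iA : ideal_gen P A = A.
    apply/eqP; rewrite eqEsubset sub_ideal_gen andbT; apply/subsetP => x.
    case/ideal_gen_mem => i iA; have /setD1P[_ iL] := subsetP AL _ iA.
    by rewrite (ideal_minimal iL).1 inE => /eqP->.
  rewrite /pweight iA -sum1_card; apply: eq_bigr => x xA.
  by have /setD1P[_ /ideal_minimal[]] := subsetP AL _ xA.
Qed.

End SmallWeight.

(** * Perfectness *)

(** The pair [{a, m}] is too heavy for [m] in [Delta P 1 2]: here [f m] is the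
    pair that represents its syndrome in the ball. *)
Lemma hamming_perfect_of_pairs k (P : wposet (2 ^ k)) a
    (f : 'I_(2 ^ k) -> {set 'I_(2 ^ k)}) :
    a \in Delta P 1 1 ->
    Delta_above P 2 2 a = ~: (Delta P 1 1 :|: Delta P 1 2) ->
    (forall A : {set 'I_(2 ^ k)}, A \subset Delta P 1 1 :\ a /\ #|A| = 2 <->
       exists2 m, m \in Delta P 1 2 & A = f m) ->
    (forall m, m \in Delta P 1 2 ->
       syndrome (ext_hamming_mx k) (vec_of (f m)) =
       (syndrome (ext_hamming_mx k) (vec_of [set a]) +
        syndrome (ext_hamming_mx k) (vec_of [set m]))%R) ->
  perfect_code P 2 (ext_hamming k).
Proof.
move=> aL rest pairs synf.
have aM : a \notin Delta P 1 2 by apply: contraL aL; apply: heavy_notin_L.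
(* Twice the column of [a] is zero, so [a] itself gets the empty set. *)
pose F y :=
  if y == a then set0 else if y \in Delta P 1 2 then f y else [set a; y].
apply: (@perfect_of_transversal _ P 2 a F) => [A|y]; last first.
  rewrite /F; case: eqVneq => [->|ya].
    rewrite vec_of0 -{1}[syndrome _ (vec_of _)]opp_mxF2 addNr.
    by rewrite /syndrome trmx0 mulmx0.
  case: ifP => [/synf //|_].
  by rewrite vec_of2 1?eq_sym // syndromeD.
split=> [/(pweight_leq2 aL rest)[->|[y ->]|[y /andP[ya yM] ->]|/pairs[m mM ->]]|].
- by right; exists a; rewrite /F eqxx.
- by left; exists y.
- by right; exists y; rewrite /F (negPf ya) (negPf yM).
- right; exists m; rewrite /F mM ifN //.
  by apply: contraNneq aM => <-.
case=> -[y ->]; apply/(pweight_leq2 aL rest).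
  by constructor 2; exists y.
rewrite /F; case: eqVneq => [_|ya]; first by constructor 1.
case: ifP => [yM|/negbT yM]; first by constructor 4; apply/pairs; exists y.
by constructor 3; exists y => //; rewrite ya.
Qed.

Theorem theorem3p8 (k : nat) (hk : 3 <= k) (P : wposet (2 ^ k))
    (a b c d b' c' d' : 'I_(2 ^ k))
    (hdist : uniq [:: a; b; c; d; b'; c'; d'])
    (h1 : vec_of [set a; b; c; d] \in ext_hamming k)
    (h2 : vec_of [set b; b'; c; c'] \in ext_hamming k)
    (h3 : vec_of [set b; b'; d; d'] \in ext_hamming k)
    (h4 : vec_of [set c; c'; d; d'] \in ext_hamming k)
    (hcase :
      ((Omega P 1 1 1, Omega P 1 2 1, Omega P 1 2 2) = (3, 1, 2 ^ k - 4) /\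
       Delta P 1 1 = [set a; b; c] /\
       Delta P 1 2 = [set d] /\
       Delta_above P 2 2 a = ~: (Delta P 1 1 :|: Delta P 1 2))
      \/
      ((Omega P 1 1 1, Omega P 1 2 1, Omega P 1 2 2) = (4, 3, 2 ^ k - 7) /\
       Delta P 1 1 = [set a; b; c; d'] /\
       Delta P 1 2 = [set b'; c'; d] /\
       Delta_above P 2 2 a = ~: (Delta P 1 1 :|: Delta P 1 2))) :
  perfect_code P 2 (ext_hamming k).
Proof.
have := hdist; rewrite /= !inE !negb_or !andbT.
case/and5P => /and5P[ab ac ad ab' /andP[ac' ad']] /and5P[bc bd bb' bc' bd']
  /and4P[cd cb' cc' cd'] /and3P[db' dc' dd'] /andP[/andP[b'c' b'd'] c'd'].
pose syn := syndrome (ext_hamming_mx k).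
have [s sE] : exists s, forall i, syn (vec_of [set i]) = s i.
  by exists (fun i => syn (vec_of [set i])).
have syn2 x y : x != y -> syn (vec_of [set x; y]) = (s x + s y)%R.
  by move=> xy; rewrite vec_of2 // /syn syndromeD -!/(syn _) !sE.
have dep x y z t : uniq [:: x; y; z; t] ->
    vec_of [set x; y; z; t] \in ext_hamming k -> (s x = s y + (s z + s t))%R.
  by rewrite -!sE; apply: hamming4.
have sa : s a = (s b + (s c + s d))%R.
  by apply: dep h1; rewrite /= !inE !negb_or ab ac ad bc bd cd.
have sb' : s b' = (s b + (s d + s d'))%R.
  have -> : s b = (s b' + (s d + s d'))%R.
    apply: dep h3; rewrite /= !inE !negb_or bb' bd bd' dd'.
    by rewrite [b' == d]eq_sym db' b'd'.
  by rewrite addrKF2.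
have sc' : s c' = (s c + (s d + s d'))%R.
  have -> : s c = (s c' + (s d + s d'))%R.
    apply: dep h4; rewrite /= !inE !negb_or cc' cd cd' dd'.
    by rewrite [c' == d]eq_sym dc' c'd'.
  by rewrite addrKF2.
have bc_ad : (s b + s c = s a + s d)%R by rewrite sa addrA addrKF2.
have bd'_ac' : (s b + s d' = s a + s c')%R by rewrite sa sc' addrKAF2.
have cd'_ab' : (s c + s d' = s a + s b')%R.
  by rewrite sa sb' [(s b + (s c + s d))%R]addrCA addrKAF2.
have aL : a \in Delta P 1 1 by case: hcase => -[_ [-> _]]; rewrite !inE eqxx.
case: hcase => -[_ [eL [eM rest]]].
  apply: (@hamming_perfect_of_pairs k P a (fun=> [set b; c]) aL rest) => [A|m].
    have -> : Delta P 1 1 :\ a = [set b; c].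
      by rewrite eL -setUA setU1K // !inE negb_or ab.
    rewrite eM; split=> [[sA cA]|[m _ ->]]; last by rewrite cards2 bc.
    by exists d; [rewrite inE|apply/eqP; rewrite eqEcard sA cards2 bc cA].
  by rewrite eM inE => /eqP ->; rewrite -!/(syn _) syn2 // !sE.
(* The word [{a, b, c', d'}] is the sum of h1 and h4, and [{a, c, b', d'}] that
   of h1 and h3. *)
pose f m :=
  if m == d then [set b; c] else if m == c' then [set b; d'] else [set c; d'].
have fd : f d = [set b; c] by rewrite /f eqxx.
have fc' : f c' = [set b; d'] by rewrite /f eqxx eq_sym (negPf dc').
have fb' : f b' = [set c; d'].
  by rewrite /f (negPf b'c') eq_sym (negPf db').
apply: (@hamming_perfect_of_pairs k P a f aL rest) => [A|m].
  have -> : Delta P 1 1 :\ a = [set b; c; d'].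
    by rewrite eL -!setUA setU1K // !inE !negb_or ab ac.
  rewrite eM; split=> [[sA /eqP/cards2P[x [y [xy eA]]]]|[m _ ->]].
    suff : [\/ A = f d, A = f c' | A = f b'].
      by case=> AE; [exists d|exists c'|exists b'];
        rewrite ?AE ?inE ?eqxx ?orbT.
    move: sA; rewrite fd fc' fb' {}eA subUset !sub1set !inE -!orbA.
    case/andP=> /or3P[] /eqP ex /or3P[] /eqP ey;
      move: xy; rewrite {}ex {}ey ?eqxx // => _;
      by [constructor 1|constructor 2|constructor 3
         |rewrite setUC; constructor 1|rewrite setUC; constructor 2
         |rewrite setUC; constructor 3].
  rewrite /f; do 2?case: ifP => _; rewrite cards2 ?bc ?bd' ?cd';
    by rewrite subUset !sub1set !inE !eqxx ?orbT.
rewrite eM !inE -!/(syn _) !sE -orbA => /or3P[] /eqP ->.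
- by rewrite fb' syn2.
- by rewrite fc' syn2.
- by rewrite fd syn2.
Qed.
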